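(* Let $S\subseteq V(K)$ be a RED:LD set on the infinite king grid $K$. Then the average share of the vertices in $S$ is at most $\frac{11}{3}$.
   Context: The infinite king grid $K$ has vertex set $\mathbb{Z}^2$, with distinct vertices $(a,b),(c,d)$ adjacent iff $\max(|a-c|,|b-d|)=1$. $N(v)$ is the open neighborhood of $v$ and $N[v]=N(v)\cup\{v\}$. A set $S\subseteq V(K)$ is a RED:LD (redundant locating-dominating) set iff (i) for all $v\in V(K)$, $|N[v]\cap S|\ge 2$; (ii) for all $v\in S$ and $u\in V(K)\setminus S$, $|((N(v)\cap S)\triangle(N(u)\cap S))\setminus\{v\}|\ge 1$; (iii) for all distinct $u,v\in V(K)\setminus S$, $|(N(v)\cap S)\triangle(N(u)\cap S)|\ge 2$. For $v\in V(K)$, $dom(v)=|N[v]\cap S|$; the share of a detector $x\in S$ is $sh(x)=\sum_{u\in N[x]}\frac{1}{dom(u)}$. The average share of the vertices in $S$ is $\limsup_{n\to\infty}\frac{1}{|S\cap Q_n|}\sum_{x\in S\cap Q_n} sh(x)$, where $Q_n=\{-n,\dots,n\}^2$; it equals the reciprocal of the density of $S$. *)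

(* Defs.v *)
From HB Require Import structures.
From mathcomp Require Import all_boot all_order all_algebra finmap.
From mathcomp Require Import zify.
From mathcomp Require Import all_classical all_reals all_analysis.

Set Implicit Arguments.
Unset Strict Implicit.
Unset Printing Implicit Defensive.

Import Order.TTheory GRing.Theory Num.Theory.

Local Open Scope classical_set_scope.
Local Open Scope ring_scope.

Definition vertex : Type := (int * int)%type.

Definition king_adj (u v : vertex) : Prop :=
  Num.max `|u.1 - v.1| `|u.2 - v.2| = 1.

Definition nbh (v : vertex) : set vertex := [set u | king_adj v u].

Definition cnbh (v : vertex) : set vertex := nbh v `|` [set v].

(* [fset_set] sends an infinite set to the empty one; [vcard] is only applied
   below to subsets of neighborhoods and boxes, which are finite by
   [finite_nbh], [finite_cnbh] and [finite_box]. *)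
Definition vcard (A : set vertex) : nat := #|` fset_set A|.

Definition redld (S : set vertex) : Prop :=
  [/\ forall v, (2 <= vcard (cnbh v `&` S))%N,
      forall v u, S v -> ~ S u ->
        (1 <= vcard (((nbh v `&` S) `+` (nbh u `&` S)) `\ v))%N
    & forall u v, ~ S u -> ~ S v -> u <> v ->
        (2 <= vcard ((nbh v `&` S) `+` (nbh u `&` S)))%N].

Definition dom (S : set vertex) (v : vertex) : nat := vcard (cnbh v `&` S).

Definition share (R : realType) (S : set vertex) (x : vertex) : R :=
  \sum_(u \in cnbh x) ((dom S u)%:R^-1 : R).

Definition box (n : nat) : set vertex :=
  [set v | - n%:Z <= v.1 <= n%:Z /\ - n%:Z <= v.2 <= n%:Z].

Definition average_share (R : realType) (S : set vertex) : \bar R :=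
  limn_esup (fun n => ((vcard (S `&` box n))%:R^-1 *
                       \sum_(x \in S `&` box n) share R S x : R)%:E).

Lemma finite_square (a b : int) (n : nat) :
  finite_set [set v : vertex | a <= v.1 <= a + n%:Z /\ b <= v.2 <= b + n%:Z].
Proof.
pose f (p : 'I_n.+1 * 'I_n.+1) : vertex := (a + p.1%:Z, b + p.2%:Z).
apply: (@sub_finite_set _ _ (f @` setT)); last first.
  by apply: finite_image; exact: finite_finset.
move=> [x y] /= [hx hy].
exists (inord `|x - a|%N, inord `|y - b|%N) => //.
by rewrite /f /= !inordK; [congr pair|..]; lia.
Qed.

Lemma finite_nbh (v : vertex) : finite_set (nbh v).
Proof.
apply: sub_finite_set (finite_square (v.1 - 1) (v.2 - 1) 2).
by move=> u; rewrite /nbh /king_adj /=; lia.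
Qed.

Lemma finite_cnbh (v : vertex) : finite_set (cnbh v).
Proof. by rewrite finite_setU; split; [exact: finite_nbh|exact: finite_set1]. Qed.

Lemma finite_box (n : nat) : finite_set (box n).
Proof.
apply: sub_finite_set (finite_square (- n%:Z) (- n%:Z) (n + n)).
by move=> u; rewrite /box /=; lia.
Qed.

(* Main.v *)
(** Every detector [x] already has share at most 11/3, so no averaging between
    detectors is needed. The share of [x] depends only on the 5x5 square
    centred at [x]. A backtracking search reveals the cells of that square one
    at a time and abandons a partial pattern as soon as either the detectors
    seen so far force the share down to 11/3, or some vertex of [N[x]] can no
    longer be dominated twice, or some pair of vertices of [N[x]] can no longer
    be told apart; it visits about 7500 nodes. *)

Require Import Defs.
From mathcomp Require Import all_boot all_order all_algebra finmap.
From mathcomp Require Import zify lra.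
From mathcomp Require Import all_classical all_reals all_analysis.
Local Open Scope ring_scope.

Set Implicit Arguments.
Unset Strict Implicit.
Unset Printing Implicit Defensive.

Import Order.TTheory GRing.Theory Num.Theory.

(** * Partial patterns *)

(* A pattern is the list of the cells revealed so far; [ones_lb] and [ones_ub]
   count the detectors of a mask with the unrevealed cells taken empty,
   respectively full. *)
Fixpoint ones_lb (m p : bitseq) : nat :=
  match m, p with
  | b :: m', c :: p' => (b && c) + ones_lb m' p'
  | _, _ => 0
  end.

Fixpoint ones_ub (m p : bitseq) : nat :=
  match m, p with
  | b :: m', c :: p' => (b && c) + ones_ub m' p'
  | _, _ => count id m
  end.

Lemma ones_lb_cat (m p r : bitseq) : (ones_lb m p <= ones_lb m (p ++ r))%N.
Proof. by elim: m p => [|b m IH] [|c p] //=; rewrite leq_add2l. Qed.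

Lemma ones_ub_count (m p : bitseq) : (ones_ub m p <= count id m)%N.
Proof.
elim: m p => [|b m IH] [|c p] //=.
by case: b c => -[]; rewrite /= leq_add.
Qed.

Lemma ones_ub_cat (m p r : bitseq) : (ones_ub m (p ++ r) <= ones_ub m p)%N.
Proof.
elim: m p => [|b m IH] [|c p] //; first exact: ones_ub_count.
by rewrite /= leq_add2l.
Qed.

(** A mask and a pattern read off the same list leave no cell unrevealed, so the lower and the upper
    count are both exact. *)
Lemma ones_lb_map (T : Type) (f g : pred T) (s : seq T) :
  ones_lb (map f s) (map g s) = count (predI f g) s.
Proof. by elim: s => //= a s ->. Qed.

Lemma ones_ub_map (T : Type) (f g : pred T) (s : seq T) :
  ones_ub (map f s) (map g s) = count (predI f g) s.
Proof. by elim: s => //= a s ->. Qed.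

(** * The search *)

Definition adjb (u v : int * int) : bool :=
  Num.max `|u.1 - v.1| `|u.2 - v.2| == 1.

Definition ball : seq (int * int) :=
  [:: (0, 0); (0, 1); (1, 0); (-1, 0); (0, -1);
      (1, 1); (1, -1); (-1, 1); (-1, -1)].

(** The order is the one in which the search reveals cells: the centre first, as it is a known
    detector, then outwards. *)
Definition window : seq (int * int) :=
  ball ++
  [:: (0, 2); (2, 0); (-2, 0); (0, -2);
      (1, 2); (2, 1); (-1, 2); (-2, 1); (1, -2); (2, -1); (-1, -2); (-2, -1);
      (2, 2); (2, -2); (-2, 2); (-2, -2)].

Definition dom_mask (u : int * int) : bitseq :=
  [seq adjb u w || (u == w) | w <- window].

(** Leaving out [u] lets one mask serve conditions (ii) and (iii): when [u] is not a detector,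
    nothing is lost. *)
Definition diff_mask (u v : int * int) : bitseq :=
  [seq (adjb u w (+) adjb v w) && (w != u) | w <- window].

Definition dom_masks : seq bitseq :=
  Eval vm_compute in [seq dom_mask u | u <- ball].

Lemma dom_masksE : dom_masks = [seq dom_mask u | u <- ball].
Proof. by vm_compute. Qed.

Definition diff_masks : seq (nat * nat * bitseq) :=
  Eval vm_compute in
    [seq (index u window, index v window, diff_mask u v)
       | u <- ball, v <- [seq v <- ball | v != u]].

Lemma diff_masksE :
  diff_masks = [seq (index u window, index v window, diff_mask u v)
                  | u <- ball, v <- [seq v <- ball | v != u]].
Proof. by vm_compute. Qed.

(* An upper bound for [12 / k] when [2 <= k]; the threshold [44] below is
   [12 * (11 / 3)]. *)
Definition weight (k : nat) : nat :=
  match k with 0 | 1 | 2 => 6 | 3 => 4 | _ => 3 end.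

Definition light (p : bitseq) : bool :=
  (sumn [seq weight (ones_lb m p) | m <- dom_masks] <= 44)%N.

(* A non-detector [v] must differ from [u] in one detector other than [u] if
   [u] is a detector, and in two otherwise; an unrevealed [u] is treated as a
   detector and an unrevealed [v] imposes nothing. *)
Definition feasible (p : bitseq) : bool :=
  all (fun m => (2 <= ones_ub m p)%N) dom_masks &&
  all (fun t => nth true p t.1.2 ||
                ((~~ nth true p t.1.1).+1 <= ones_ub t.2 p)%N) diff_masks.

Definition pruned (p : bitseq) : bool := light p || ~~ feasible p.

(* Conditionals rather than [&&] and [||], whose arguments call-by-value
   evaluation would all compute. *)
Fixpoint search (n : nat) (p : bitseq) : bool :=
  if pruned p then true else
  if n is n'.+1 then
    if search n' (rcons p true) then search n' (rcons p false) else false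
  else false.

(** * Soundness of pruning and of the search *)

Lemma weight_anti (k l : nat) : (k <= l)%N -> (weight l <= weight k)%N.
Proof. by move: k l => [|[|[|[|k]]]] [|[|[|[|l]]]]. Qed.

Lemma light_cat (p r : bitseq) : light p -> light (p ++ r).
Proof.
apply: leq_trans; elim: dom_masks => //= m s IH.
by rewrite leq_add// weight_anti// ones_lb_cat.
Qed.

Lemma nth_true_cat (p r : bitseq) (i : nat) :
  nth true (p ++ r) i -> nth true p i.
Proof. by rewrite nth_cat; case: ltnP => // ? _; rewrite nth_default. Qed.

(** Unrevealed cells count as full in [ones_ub] and read as [true] in [nth], so each requirement is
    weakest on the shorter pattern. *)
Lemma feasible_cat (p r : bitseq) : feasible (p ++ r) -> feasible p.
Proof.
case/andP=> /allP hdom /allP hdiff; apply/andP; split; apply/allP => t ht.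
  exact: leq_trans (hdom t ht) (ones_ub_cat _ _ _).
case/orP: (hdiff t ht) => [/nth_true_cat->//|hle].
apply/orP; right; apply: leq_trans (ones_ub_cat _ _ r); apply: leq_trans hle.
case: (boolP (nth true (p ++ r) t.1.1)) => [/nth_true_cat->//|_].
by rewrite ltnS leq_b1.
Qed.

Lemma pruned_cat (p r : bitseq) : pruned p -> pruned (p ++ r).
Proof.
case/orP => [/light_cat h|h]; apply/orP; [by left; exact: h|right].
by apply: contra h; exact: feasible_cat.
Qed.

Lemma searchP (n : nat) (p r : bitseq) :
  search n p -> size r = n -> pruned (p ++ r).
Proof.
elim: n p r => [|n IH] p r /=; case: ifP => // hp;
  try by move=> *; exact: pruned_cat.
(* The first cell of [r] selects the branch to follow. *)
case: ifP => // ht hf; case: r => // -[] r [hr]; rewrite -cat_rcons; exact: IH.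
Qed.

(** Besides the centre, the 5x5 window has 24 cells to reveal. *)
Lemma search_window : search 24 [:: true].
Proof. by vm_compute. Qed.

(** * Reading the pattern around a vertex *)

Definition shift (x v : vertex) : vertex := (x.1 + v.1, x.2 + v.2).

Lemma shift_inj (x : vertex) : injective (shift x).
Proof. by case: x => a b [c d] [e f] [/addrI-> /addrI->]. Qed.

Lemma shift0 (x : vertex) : shift x (0, 0) = x.
Proof. by case: x => a b; rewrite /shift /= !addr0. Qed.

Lemma shift_eq (x u v : vertex) : shift x u = shift x v <-> u = v.
Proof. by split=> [/shift_inj|->]. Qed.

Lemma shiftP (x v : vertex) : v = shift x (v.1 - x.1, v.2 - x.2).
Proof. by case: v => a b; rewrite /shift /= !subrKC. Qed.

Lemma king_adj_shift (x u v : vertex) :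
  king_adj (shift x u) (shift x v) <-> adjb u v.
Proof.
rewrite /king_adj /adjb /=.
have E (a b c : int) : a + b - (a + c) = b - c by lia.
by rewrite !E; split => [->|/eqP].
Qed.

Lemma window_uniq : uniq window. Proof. by vm_compute. Qed.

Lemma mem_window (v : vertex) : `|v.1| <= 2 -> `|v.2| <= 2 -> v \in window.
Proof.
case: v => a b /= ha hb.
have : a \in [:: -2; -1; 0; 1; 2] by rewrite !inE; lia.
have : b \in [:: -2; -1; 0; 1; 2] by rewrite !inE; lia.
by rewrite !inE => /or4P[|||/orP[]] /eqP-> /or4P[|||/orP[]] /eqP->.
Qed.

Lemma mem_ball (v : vertex) : (v \in ball) = (`|v.1| <= 1) && (`|v.2| <= 1).
Proof.
case: v => a b /=; apply/idP/idP => [|/andP[ha hb]].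
  by rewrite !inE !xpair_eqE; lia.
have : a \in [:: -1; 0; 1] by rewrite !inE; lia.
have : b \in [:: -1; 0; 1] by rewrite !inE; lia.
by rewrite !inE => /or3P[] /eqP-> /or3P[] /eqP->.
Qed.

Lemma ball_window (u : vertex) : u \in ball -> u \in window.
Proof. by rewrite mem_cat => ->. Qed.

Lemma adjb_window (u v : vertex) : u \in ball -> adjb u v -> v \in window.
Proof.
rewrite mem_ball /adjb => /andP[h1 h2] /eqP h.
by apply: mem_window; lia.
Qed.

Lemma vcard_count (A : set vertex) (s : seq vertex) :
  uniq s -> (forall v, A v -> v \in s) -> vcard A = count (fun v => `[<A v>]) s.
Proof.
move=> us hA; rewrite /vcard -size_filter.
have finA : finite_set A.
  by apply: sub_finite_set (finite_seq s) => v /hA.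
rewrite -[in RHS](undup_id (filter_uniq _ us)) -card_fseq; congr #|` _|.
apply/fsetP => v; rewrite in_fset_set// !inE mem_filter.
apply/idP/idP => [/set_mem h|/andP[/asboolP h _]]; last exact/mem_set.
by rewrite hA// andbT; apply/asboolP.
Qed.

Lemma vcard_shift (A : set vertex) (x : vertex) :
    (forall v, A (shift x v) -> v \in window) ->
  vcard A = count (fun v => `[<A (shift x v)>]) window.
Proof.
move=> hA; rewrite (@vcard_count _ (map (shift x) window)) ?count_map//.
  by rewrite map_inj_uniq ?window_uniq//; exact: shift_inj.
by move=> v; rewrite {1 2}(shiftP x v) => /hA h; exact: map_f.
Qed.

Definition pattern (S : set vertex) (x : vertex) : bitseq :=
  [seq `[<S (shift x v)>] | v <- window].

Lemma dom_pattern (S : set vertex) (x u : vertex) : u \in ball ->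
  dom S (shift x u) = ones_lb (dom_mask u) (pattern S x).
Proof.
move=> hu; rewrite /dom ones_lb_map (vcard_shift (x := x)).
  apply: eq_count => v /=; apply/asboolP/andP.
    case=> -[/king_adj_shift->|/shift_eq->] hS.
      by split => //; apply/asboolP.
    by rewrite eqxx orbT; split => //; apply/asboolP.
  case=> /orP[h|/eqP->] /asboolP hS; split => //; last by right.
  by left; exact/king_adj_shift.
move=> v [[/king_adj_shift/adjb_window->//|/shift_eq->] _].
exact: ball_window.
Qed.

Lemma nth_pattern (S : set vertex) (x u : vertex) : u \in ball ->
  nth true (pattern S x) (index u window) = `[<S (shift x u)>].
Proof.
move=> /ball_window hu.
by rewrite (nth_map u) ?index_mem// nth_index.
Qed.

Lemma diff_pattern (S : set vertex) (x u v : vertex) :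
    u \in ball -> v \in ball ->
  vcard (((nbh (shift x u) `&` S) `+` (nbh (shift x v) `&` S))
           `\ shift x u)%classic
  = ones_ub (diff_mask u v) (pattern S x).
Proof.
move=> hu hv; rewrite ones_ub_map (vcard_shift (x := x)).
  apply: eq_count => w /=.
  have E z : (nbh (shift x z) `&` S)%classic (shift x w) <->
             adjb z w && `[<S (shift x w)>].
    split=> [[/king_adj_shift-> /asboolP->]//|/andP[h /asboolP hS]].
    by split => //; exact/king_adj_shift.
  apply/asboolP/idP.
    case=> hd /shift_eq/eqP->; rewrite andbT.
    by case: hd => -[/E/andP[h1 h2] /E/negP]; rewrite h1 h2 andbT => /negPf->.
  case/andP=> /andP[hadj /eqP hw] hS; split; last by move/shift_eq.
  move: hadj; case hu' : (adjb u w); case hv' : (adjb v w) => //= _;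
    [left|right].
    by split; [apply/E; rewrite hu'|move/E; rewrite hv'].
  by split; [apply/E; rewrite hv'|move/E; rewrite hu'].
by move=> w [[[[/king_adj_shift h _] _]|[[/king_adj_shift h _] _]] _];
  apply: adjb_window h.
Qed.

(* Unifying [index u window] with [index v window] would otherwise compute. *)
Opaque window.

Lemma feasible_pattern (S : set vertex) (x : vertex) :
  redld S -> feasible (pattern S x).
Proof.
case=> hdom hloc hdis; apply/andP; split; apply/allP => t.
  rewrite dom_masksE => /mapP[u hu ->].
  by rewrite ones_ub_map -ones_lb_map -dom_pattern// hdom.
rewrite diff_masksE => /allpairsPdep[u [v [hu]]].
rewrite mem_filter => /andP[vu hv] -> /=.
rewrite !nth_pattern// -diff_pattern//.
case: asboolP => //= hSv; case: asboolP => hSu; first exact: hloc.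
(* Neither vertex is a detector here: deleting [shift x u] from a set of detectors changes nothing,
   and (iii) applies. *)
rewrite not_setD1; last first.
  by case=> -[[_ hu'] _]; apply: hSu.
by apply: hdis => //; move/shift_inj/eqP; apply/negP.
Qed.

Transparent window.

Lemma pruned_pattern (S : set vertex) (x : vertex) :
  S x -> pruned (pattern S x).
Proof.
move=> /asboolP hS; have := searchP search_window (r := behead (pattern S x)).
by rewrite /pattern /= shift0 hS; apply.
Qed.

(** * The share bound and its average *)

Lemma le_weight (R : realType) (k : nat) :
  (2 <= k)%N -> k%:R^-1 <= (weight k)%:R / 12 :> R.
Proof.
move=> k2; have k0 : 0 < k%:R :> R by rewrite ltr0n; lia.
rewrite ler_pdivlMr// mulrC ler_pdivrMr// -natrM ler_nat.
by move: k k2 {k0} => [|[|[|[|k]]]] //= _; lia.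
Qed.

Lemma share_le (R : realType) (S : set vertex) (x : vertex) :
  redld S -> S x -> share R S x <= 11 / 3.
Proof.
move=> hS Sx.
(* The complete pattern is feasible, so it can only have been pruned for being light. *)
have /orP[hl|] := pruned_pattern Sx; last by rewrite feasible_pattern.
have -> : share R S x = \sum_(u <- ball) (dom S (shift x u))%:R^-1.
  rewrite -(big_map (shift x) predT (fun u => (dom S u)%:R^-1)).
  rewrite fsbig_seq; last first.
    by rewrite map_inj_uniq//; exact: shift_inj.
  congr (\big[_/_]_(_ \in _) _); apply/seteqP; split => v.
    move=> hv; suff: v \in map (shift x) ball by [].
    rewrite (shiftP x v); apply: map_f; rewrite mem_ball /=.
    by case: hv => [|->]; rewrite /nbh /king_adj /=; lia.
  case/mapP => u; rewrite mem_ball => /andP[h1 h2] ->.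
  have [->|/eqP hu] := eqVneq u (0, 0); first by right; rewrite shift0.
  left; rewrite /nbh /king_adj /shift /=; case: u h1 h2 hu => a b /= h1 h2 hu.
  have : ~ (a = 0 /\ b = 0) by case=> ? ?; apply: hu; congr pair.
  lia.
apply: (@le_trans _ _ (\sum_(u <- ball) (weight (dom S (shift x u)))%:R / 12)).
  by apply: ler_sum => u _; apply: le_weight; case: hS => + _ _; apply.
rewrite -mulr_suml -natr_sum.
suff : (\sum_(u <- ball) weight (dom S (shift x u)) <= 44)%N.
  by rewrite -(ler_nat R) => h; lra.
rewrite (eq_big_seq (fun u => weight (ones_lb (dom_mask u) (pattern S x)))).
  by move: hl; rewrite /light dom_masksE -map_comp sumnE big_map.
by move=> u hu; rewrite dom_pattern.
Qed.

Theorem theorem6 (R : realType) (S : set vertex) (hS : redld S) :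
  (average_share R S <= (11%:R / 3%:R)%:E)%E.
Proof.
(* The limit superior is an infimum of suprema; the supremum over all indices already obeys the
   bound. *)
apply: ge_ereal_inf; eexists.
  by exists setT; [exact: filterT|reflexivity].
apply: ge_ereal_sup => _ [n _ <-]; rewrite lee_fin.
have fin : finite_set (S `&` box n)%classic.
  by apply: sub_finite_set (finite_box n) => v [].
rewrite fsbig_finite//= /vcard; set A := fset_set _.
(* A box without detectors contributes 0, since the inverse of 0 is 0. *)
have [->|A0] := eqVneq #|` A| 0%N; first by rewrite invr0 mul0r; lra.
rewrite mulrC ler_pdivrMr ?ltr0n ?lt0n// mulr_natr.
(* The bound becomes a constant sum over the same detectors, to be compared term by term. *)
rewrite -iter_addr_0 -(count_predT A) -(big_const_seq 0 +%R A predT) !big_seq.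
apply: ler_sum => x; rewrite in_fset_set// => /set_mem[Sx _].
exact: share_le.
Qed.
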